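(* For every nonnegative integer $n$, $a(25n+22)\equiv 0 \pmod 5$.
   Context: Let $(q;q)_\infty=\prod_{n=1}^\infty(1-q^n)$ and $(q^2;q^2)_\infty=\prod_{n=1}^\infty(1-q^{2n})$. The number of cubic partitions $a(n)$ is defined for $n\ge 0$ by the generating function $\sum_{n=0}^\infty a(n)q^n=\frac{1}{(q;q)_\infty(q^2;q^2)_\infty}$; equivalently, $a(n)$ is the number of pairs of partitions $(\lambda,\mu)$ with $|\lambda|+|\mu|=n$ and all parts of $\mu$ even. *)

(* Defs.v *)
From mathcomp Require Import all_boot all_order all_algebra.

Set Implicit Arguments.
Unset Strict Implicit.
Unset Printing Implicit Defensive.

Import GRing.Theory.
Local Open Scope ring_scope.

(* A formal power series over Z is its sequence of coefficients. *)
Definition pseries := nat -> int.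

Definition ps_one : pseries := fun n => (n == 0%N)%:R.

Definition ps_mul (f g : pseries) : pseries :=
  fun n => \sum_(k < n.+1) f k * g (n - k)%N.

(* For f 0 = 1, the list [:: g n; ...; g 0] of coefficients of g = 1/f, by the
   recurrence g 0 = 1 and g (n+1) = - (f 1 * g n + ... + f (n+1) * g 0). *)
Fixpoint ps_inv_rev (f : pseries) (n : nat) : seq int :=
  if n is m.+1 then
    let s := ps_inv_rev f m in (- \sum_(k < m.+1) f k.+1 * s`_k) :: s
  else [:: 1].

(* 1/f; only meaningful when f 0 = 1, see [ps_mulV]. *)
Definition ps_inv (f : pseries) : pseries := fun n => head 0 (ps_inv_rev f n).

(* (q^m; q^m)_oo for m > 0: factors of index i > n do not affect the coefficient
   of q^n, so it is read off the partial product up to i = n, see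
   [coef_qprod]. *)
Definition qprod (m : nat) : pseries :=
  fun n => (\prod_(1 <= i < n.+1) (1 - 'X^(m * i)) : {poly int})`_n.

Definition cubic_partitions : pseries :=
  ps_inv (ps_mul (qprod 1) (qprod 2)).

Lemma nth_ps_inv_rev (f : pseries) (n k : nat) :
  (k <= n)%N -> (ps_inv_rev f n)`_k = ps_inv f (n - k)%N.
Proof.
elim: n k => [|n IHn] [|k] //= le_kn; by rewrite IHn.
Qed.

Lemma ps_mulV (f : pseries) : f 0%N = 1 -> ps_mul f (ps_inv f) =1 ps_one.
Proof.
move=> f0 [|n]; rewrite /ps_mul big_ord_recl f0 mul1r subn0 /ps_one.
  by rewrite big_ord0 addr0.
rewrite {1}/ps_inv /= [X in - X + _](_ : _ =
  \sum_(k < n.+1) f (lift ord0 k) * ps_inv f (n.+1 - lift ord0 k)%N).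
  by rewrite addNr.
apply: eq_bigr => k _; rewrite nth_ps_inv_rev; first by rewrite lift0 subSS.
by rewrite -ltnS.
Qed.

Lemma coef_qprod (m n N : nat) : (0 < m)%N -> (n <= N)%N ->
  (\prod_(1 <= i < N.+1) (1 - 'X^(m * i)) : {poly int})`_n = qprod m n.
Proof.
move=> m_gt0; elim: N => [|N IHN]; first by rewrite leqn0 => /eqP ->.
rewrite leq_eqVlt => /predU1P[-> // | lt_nN].
rewrite big_nat_recr //= mulrBr mulr1 coefB coefMXn IHN //.
by rewrite (leq_trans lt_nN (leq_pmull _ m_gt0)) subr0.
Qed.

Lemma cubic_partitions_gf :
  ps_mul (ps_mul (qprod 1) (qprod 2)) cubic_partitions =1 ps_one.
Proof.
apply: ps_mulV; rewrite /ps_mul big_ord_recl big_ord0 addr0 /qprod.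
by rewrite !big_geq // coef1 mulr1.
Qed.

(* Main.v *)
(* Write e = (q;q) and f = (q^2;q^2), as power series over F_5, so that
   e(q^5) = e^5. Since 1/(ef) = (ef)^4 / (ef)^5, the terms of 1/(ef) with
   exponents 2 mod 5 are those of (ef)^4 divided by (ef)^5. The key fact is that
   the former sum to -2 q^2 (ef)^20, whence the terms of 1/(ef) sum to
   -2 q^2 (e^3 f^3)(q^5); and e^3 f^3 has no exponent 4 mod 5, because by Jacobi
   e^3 = sum (-1)^j (2j+1) q^(j(j+1)/2), where 2j+1 = 0 mod 5 as soon as the
   exponent is 3 mod 5.

   For the key fact, split e = a0 + a1 + a2 and f = b0 + b1 + b2 by exponents mod
   5. Euler's pentagonal series gives a1 = - q e^25 and b1 = - q^2 f^25, and
   Jacobi's series gives a0 a2 = - a1^2 and b0 b2 = - b1^2. Put x = a0/a1 and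
   y = b0/b1. Splitting e psi = f^2, where psi = sum q^(j(j+1)/2) has no exponent
   2 or 4 mod 5, yields (y - x^2)(x^3 y^2 + x y^3 + x^2 - y) = 0. Hence x^5, y^5,
   y/x^2 are rational functions of t = x y^2, and so is the required part S of
   (ef)^4/(a1 b1)^4. One finds S = -2 rho^2 and (ef/(a1 b1))^5 = rho^3 with
   rho = (t^2 - t - 1)^2 / (t (1 - t^2)). As a1 b1 = q^3 (ef)^25, the cube of
   rho q^5 (ef)^40 is 1, and 1 is the only cube root of 1 in F_5((q)). *)

Require Import Defs.
From mathcomp Require Import all_boot all_order all_algebra.
From HB Require Import structures.
From mathcomp Require Import all_field boolp ring zify.

Set Implicit Arguments.
Unset Strict Implicit.
Unset Printing Implicit Defensive.

Import Order.TTheory GRing.Theory Num.Theory.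
Local Open Scope ring_scope.

(** * Formal power series *)

Record fps (K : Type) := Fps { fcoef :> nat -> K }.

Lemma fpsP (K : Type) (f g : fps K) : f =1 g -> f = g.
Proof. by case: f => f; case: g => g /= /funext ->. Qed.

HB.instance Definition _ (K : Type) := gen_eqMixin (fps K).
HB.instance Definition _ (K : Type) := gen_choiceMixin (fps K).

Section FpsRing.

Variable K : comNzRingType.
Implicit Types (f g h : fps K) (p r : {poly K}).

Definition fps_trunc N f : {poly K} := \poly_(i < N) f i.
Definition fps_of_poly p := Fps (fun n => p`_n).

Let zero := Fps (fun _ => 0 : K).
Let opp f := Fps (fun n => - f n).
Let add f g := Fps (fun n => f n + g n).

Fact fps_addA : associative add.
Proof. by move=> f g h; apply: fpsP => n /=; rewrite addrA. Qed.
Fact fps_addC : commutative add.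
Proof. by move=> f g; apply: fpsP => n /=; rewrite addrC. Qed.
Fact fps_add0 : left_id zero add.
Proof. by move=> f; apply: fpsP => n /=; rewrite add0r. Qed.
Fact fps_addN : left_inverse zero opp add.
Proof. by move=> f; apply: fpsP => n /=; rewrite addNr. Qed.

HB.instance Definition _ :=
  GRing.isZmodule.Build (fps K) fps_addA fps_addC fps_add0 fps_addN.

Let one := fps_of_poly 1.
Let mul f g := Fps (fun n => \sum_(k < n.+1) f k * g (n - k)%N).

Fact coef_fps_trunc N f n : (fps_trunc N f)`_n = if (n < N)%N then f n else 0.
Proof. exact: coef_poly. Qed.

(** A coefficient of a product depends only on truncations, so associativity and commutativity are
    inherited from [{poly K}]. *)
Fact fps_mul_trunc f g N n : (n < N)%N ->
  mul f g n = (fps_trunc N f * fps_trunc N g)`_n.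
Proof.
move=> ltnN /=; rewrite coefM; apply: eq_bigr => -[k /= ltk] _.
rewrite !coef_fps_trunc ifT ?ifT //; lia.
Qed.

Fact coefM_eq p p' r r' N :
    (forall n, (n < N)%N -> p`_n = p'`_n) ->
    (forall n, (n < N)%N -> r`_n = r'`_n) ->
  forall n, (n < N)%N -> (p * r)`_n = (p' * r')`_n.
Proof.
move=> eqp eqr n ltnN; rewrite !coefM; apply: eq_bigr => -[k /= ltk] _.
rewrite eqp ?eqr //; lia.
Qed.

Fact trunc_mul f g N n : (n < N)%N ->
  (fps_trunc N (mul f g))`_n = (fps_trunc N f * fps_trunc N g)`_n.
Proof. by move=> ltnN; rewrite coef_fps_trunc ltnN (fps_mul_trunc _ _ ltnN). Qed.

Fact fps_mulC : commutative mul.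
Proof.
by move=> f g; apply: fpsP => n; rewrite !(@fps_mul_trunc _ _ n.+1) // mulrC.
Qed.
Fact fps_mulA : associative mul.
Proof.
move=> f g h; apply: fpsP => n; rewrite !(@fps_mul_trunc _ _ n.+1) //.
rewrite (coefM_eq (fun _ _ => erefl) (@trunc_mul _ _ n.+1)) //.
by rewrite mulrA; symmetry; apply: (coefM_eq (@trunc_mul _ _ n.+1)).
Qed.
Fact fps_mul1 : left_id one mul.
Proof.
move=> f; apply: fpsP => n /=; rewrite big_ord_recl coef1 mul1r subn0.
by rewrite big1 ?addr0 // => i _; rewrite coef1 mul0r.
Qed.
Fact fps_mulD : left_distributive mul add.
Proof.
move=> f g h; apply: fpsP => n /=; rewrite -big_split /=.
by apply: eq_bigr => i _; rewrite mulrDl.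
Qed.
Fact fps_one_neq0 : one != 0.
Proof.
by apply/eqP => /(congr1 (fun f : fps K => f 0%N))/eqP; rewrite /= coef1 oner_eq0.
Qed.

HB.instance Definition _ := GRing.Zmodule_isComNzRing.Build (fps K)
  fps_mulA fps_mulC fps_mul1 fps_mulD fps_one_neq0.

Let unit : {pred fps K} := fun f => `[< exists g, g * f = 1 >].
Let inv f := if pselect (exists g, g * f = 1) is left ex
             then projT1 (cid ex) else f.

Fact fps_mulV : {in unit, left_inverse 1 inv *%R}.
Proof. by move=> f /asboolP uf; rewrite /inv; case: pselect => // ?; case: cid. Qed.
Fact fps_unitP f g : g * f = 1 -> unit f.
Proof. by move=> gf1; apply/asboolP; exists g. Qed.
Fact fps_inv_out : {in [predC unit], inv =1 id}.
Proof. by move=> f /asboolP uf; rewrite /inv; case: pselect. Qed.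

HB.instance Definition _ := GRing.ComNzRing_hasMulInverse.Build (fps K)
  fps_mulV fps_unitP fps_inv_out.

Lemma coef_fpsD f g n : (f + g) n = f n + g n. Proof. by []. Qed.
Lemma coef_fpsN f n : (- f) n = - f n. Proof. by []. Qed.
Lemma coef_fps0 n : (0 : fps K) n = 0. Proof. by []. Qed.
Lemma coef_fpsM f g n : (f * g) n = \sum_(k < n.+1) f k * g (n - k)%N.
Proof. by []. Qed.
Lemma coef_fps1 n : (1 : fps K) n = (n == 0%N)%:R.
Proof. exact: coef1. Qed.
Lemma coef0_fpsM f g : (f * g) 0%N = f 0%N * g 0%N.
Proof. by rewrite coef_fpsM big_ord_recl big_ord0 addr0. Qed.
Lemma coef_fpsMn f k n : (f *+ k) n = f n *+ k.
Proof. by elim: k => // k IHk; rewrite !mulrS coef_fpsD IHk. Qed.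
Lemma coef_fps_sum I (r : seq I) (P : pred I) (F : I -> fps K) n :
  (\sum_(i <- r | P i) F i) n = \sum_(i <- r | P i) F i n.
Proof. by elim/big_rec2: _ => // i x y _ <-. Qed.

Fact fps_of_poly_is_zmod_morphism : zmod_morphism fps_of_poly.
Proof. by move=> p r; apply: fpsP => n /=; rewrite coefB. Qed.
Fact fps_of_poly_is_monoid_morphism : monoid_morphism fps_of_poly.
Proof. by split=> // p r; apply: fpsP => n /=; rewrite coefM. Qed.
HB.instance Definition _ := GRing.isZmodMorphism.Build {poly K} (fps K)
  fps_of_poly fps_of_poly_is_zmod_morphism.
HB.instance Definition _ := GRing.isMonoidMorphism.Build {poly K} (fps K)
  fps_of_poly fps_of_poly_is_monoid_morphism.

Definition fpsX : fps K := fps_of_poly 'X.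

Lemma fpsXn m : fpsX ^+ m = fps_of_poly 'X^m.
Proof. by rewrite rmorphXn. Qed.

Lemma coef_fpsXn m n : (fpsX ^+ m) n = (n == m)%:R.
Proof. by rewrite fpsXn; apply: coefXn. Qed.

Lemma coef_fpsXnM m f n :
  (fpsX ^+ m * f) n = if (n < m)%N then 0 else f (n - m)%N.
Proof.
rewrite fpsXn (@fps_mul_trunc _ _ n.+1) //=.
rewrite (coefM_eq (p' := 'X^m) _ (fun _ _ => erefl) (ltnSn n)); last first.
  by move=> k ltkn; rewrite coef_fps_trunc ltkn.
by rewrite coefXnM coef_fps_trunc; case: ifP => // ?; rewrite ifT //; lia.
Qed.

(** Congruence modulo X^N, by which finite identities pass to the limit. *)
Definition eqfps N f g := forall n, (n < N)%N -> f n = g n.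

Lemma eqfpsP N f g : eqfps N f g <-> exists h, f = g + fpsX ^+ N * h.
Proof.
split=> [eqfg | [h ->] n ltnN]; last by rewrite coef_fpsD coef_fpsXnM ltnN addr0.
exists (Fps (fun n => f (n + N)%N - g (n + N)%N)); apply: fpsP => n.
rewrite coef_fpsD coef_fpsXnM; case: ltnP => [/eqfg -> | leNn] /=.
  by rewrite addr0.
by rewrite subnK // addrC subrK.
Qed.

Lemma eqfps_sym N f g : eqfps N f g -> eqfps N g f.
Proof. by move=> fg n /fg. Qed.

Lemma eqfps_trans N f g h : eqfps N f g -> eqfps N g h -> eqfps N f h.
Proof. by move=> fg gh n ltnN; rewrite fg ?gh. Qed.

Lemma eqfpsM N f f' g g' : eqfps N f f' -> eqfps N g g' -> eqfps N (f * g) (f' * g').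
Proof.
move=> /eqfpsP[h ->] /eqfpsP[k ->]; apply/eqfpsP.
by exists (f' * k + h * g' + h * fpsX ^+ N * k); ring.
Qed.

Lemma eqfpsX N f f' k : eqfps N f f' -> eqfps N (f ^+ k) (f' ^+ k).
Proof. by move=> ff'; elim: k => // k IHk; rewrite !exprS; apply: eqfpsM. Qed.

Lemma eqfps_sum N I (r : seq I) (P : pred I) (F G : I -> fps K) :
  (forall i, P i -> eqfps N (F i) (G i)) ->
  eqfps N (\sum_(i <- r | P i) F i) (\sum_(i <- r | P i) G i).
Proof.
by move=> FG n ltnN; rewrite !coef_fps_sum; apply: eq_bigr => i Pi; apply: FG.
Qed.

Lemma eqfps_trunc N f : eqfps N f (fps_of_poly (fps_trunc N f)).
Proof. by move=> n ltnN; rewrite /= coef_fps_trunc ltnN. Qed.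

Lemma eqfpsW M N f g : (M <= N)%N -> eqfps N f g -> eqfps M f g.
Proof. by move=> leMN fg n ltnM; apply: fg; apply: leq_trans leMN. Qed.

Lemma eqfps_shift k N f g :
  eqfps N f g -> eqfps (k + N) (fpsX ^+ k * f) (fpsX ^+ k * g).
Proof.
move=> fg n ltn; rewrite !coef_fpsXnM; case: ltnP => // lekn; apply: fg; lia.
Qed.

Lemma eqfps_all f g : (forall N, eqfps N f g) -> f = g.
Proof. by move=> fg; apply: fpsP => n; apply: (fg n.+1). Qed.

Lemma fps_eqX f : f 0%N = 0 -> exists g, f = fpsX * g.
Proof.
move=> f0; have /eqfpsP[g ->] : eqfps 1 f 0 by move=> [].
by exists g; rewrite add0r.
Qed.

(* A series with constant coefficient 1 is invertible modulo any power of X. *)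
Lemma eqfps_mulI N (u f g : fps K) :
  u 0%N = 1 -> eqfps N (u * f) (u * g) -> eqfps N f g.
Proof.
move=> u0 uf; elim/ltn_ind => n IHn ltnN; move: (uf n ltnN).
rewrite !coef_fpsM !big_ord_recl u0 !mul1r !subn0.
rewrite [X in f n + X](eq_bigr (fun i => u (lift ord0 i) * g (n - lift ord0 i)%N)).
  exact: addIr.
by case=> i lti _ /=; rewrite IHn // /bump /=; lia.
Qed.

End FpsRing.

(** * Integrality of the ring of power series *)

Section FpsDomain.

Variable K : idomainType.
Implicit Types f g : fps K.

Lemma fps_neq0P f : f != 0 -> exists k g, f = fpsX K ^+ k * g /\ g 0%N != 0.
Proof.
move=> nzf; have exf : exists n, f n != 0.
  by apply: contrapT => nof; case/eqP: nzf; apply: fpsP => n;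
     apply/eqP/negPn/negP => nzfn; apply: nof; exists n.
case: (ex_minnP exf) => k nzfk mink; exists k.
have /eqfpsP[g Df] : eqfps k f 0.
  move=> n ltnk; apply/eqP/negPn/negP => /mink; lia.
exists g; rewrite add0r in Df; split=> //.
by move: nzfk; rewrite Df coef_fpsXnM ltnn subnn.
Qed.

Fact fps_integral : GRing.integral_domain_axiom (fps K).
Proof.
move=> f g fg0; apply/norP => -[/fps_neq0P[k [f' [Df nzf]]]].
case/fps_neq0P=> l [g' [Dg nzg]]; have /eqP[] := mulf_neq0 nzf nzg.
rewrite -coef0_fpsM; have /(congr1 (fun h : fps K => h (k + l)%N)) := fg0.
rewrite Df Dg mulrACA -exprD coef_fpsXnM ltnn subnn; exact.
Qed.

HB.instance Definition _ := GRing.ComUnitRing_isIntegral.Build (fps K) fps_integral.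

Lemma fpsX_neq0 : fpsX K != 0.
Proof.
apply/eqP => /(congr1 (fun f : fps K => f 1%N))/eqP.
by rewrite -[fpsX K]expr1 coef_fpsXn eqxx oner_eq0.
Qed.

End FpsDomain.

(** * The finite Jacobi triple product *)

(* With j = k - n, possibly negative, this is j(j-1)/2. *)
Definition tri (k n : nat) : nat :=
  if (n <= k)%N then 'C(k - n, 2) else 'C((n - k).+1, 2).

Lemma triSS k n : tri k.+1 n.+1 = tri k n.
Proof. by rewrite /tri ltnS !subSS. Qed.

(** The recurrence (j+1)j/2 = j + j(j-1)/2 for j = k - n, free of subtraction. *)
Lemma tri_rec k n : (n + tri k.+1 n = k + tri k n)%N.
Proof.
have binS2 d : 'C(d.+1, 2) = ('C(d, 2) + d)%N by rewrite binS bin1.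
rewrite /tri; case: (leqP n k) => [lenk | ltkn].
  by rewrite leqW // subSn // binS2; lia.
case: (ltngtP n k.+1) => [ltn | ltn | eqn]; [lia | | ].
  by rewrite subnSK // binS2; lia.
by rewrite -eqn subnn [in RHS]eqn subSnn binn bin0n addn0 addn1.
Qed.

Section QBinomial.

Variables (R : comNzRingType) (q : R).

Definition qfac k : R := \prod_(i < k) (1 - q ^+ i.+1).

(** Gaussian binomials by the q-Pascal rule, hence without division. *)
Fixpoint qbin n k : R :=
  match n, k with
  | _, 0 => 1
  | 0, _.+1 => 0
  | n'.+1, k'.+1 => qbin n' k' + q ^+ k * qbin n' k
  end.

Arguments qbin : simpl never.

Lemma qbin0 n : qbin n 0 = 1. Proof. by case: n. Qed.

Lemma qbinS n k : qbin n.+1 k.+1 = qbin n k + q ^+ k.+1 * qbin n k.+1.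
Proof. by []. Qed.

Lemma qbin_small n k : (n < k)%N -> qbin n k = 0.
Proof.
elim: n k => [|n IHn] [|k] //; rewrite ltnS => ltnk.
by rewrite qbinS !IHn ?mulr0 ?addr0 // ltnW.
Qed.

Lemma qbinn n : qbin n n = 1.
Proof. by elim: n => // n IHn; rewrite qbinS IHn qbin_small // mulr0 addr0. Qed.

(** The other q-Pascal rule. In the triple product, [qbinS] adds a factor z + q^i and this rule a
    factor 1 + z q^i. *)
Lemma qbinS_dual n k : (k <= n)%N ->
  qbin n.+1 k.+1 = q ^+ (n - k) * qbin n k + qbin n k.+1.
Proof.
elim: n k => [|n IHn] k; first by rewrite leqn0 => /eqP->; rewrite /qbin /= mulr0 mulr1.
rewrite leq_eqVlt => /predU1P[-> | ].
  by rewrite subnn !qbinn qbin_small // mulr1 addr0.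
rewrite ltnS => lekn; rewrite qbinS {1}(IHn k lekn).
case: k lekn => [_ | k ltkn].
  by rewrite !qbin0 !subn0 (qbinS n 0) qbin0 (exprS q n); ring.
rewrite {1}(IHn k (ltnW ltkn)) subSS (qbinS n k) (qbinS n k.+1).
rewrite (_ : n - k = (n - k.+1).+1)%N; last by lia.
by rewrite (exprS q k.+1) (exprS q (n - k.+1)%N); ring.
Qed.

Lemma qbin_fac n k : (k <= n)%N -> qbin n k * qfac k * qfac (n - k) = qfac n.
Proof.
elim: n k => [|n IHn] [|k].
- by rewrite /qfac !big_ord0 !mulr1.
- by [].
- by rewrite qbin0 subn0 /qfac big_ord0 !mul1r.
rewrite ltnS subSS => lekn; rewrite qbinS.
have facS d : qfac d.+1 = qfac d * (1 - q ^+ d.+1) by rewrite /qfac big_ord_recr.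
rewrite [RHS]facS (facS k); have IH1 := IHn k lekn.
case: (ltngtP k n) lekn IH1 => // [ltkn _ | -> _ _]; last first.
  by rewrite qbinn subnn qbin_small // /qfac big_ord0; ring.
have := IHn k.+1 ltkn; rewrite (facS k) (_ : n - k = (n - k.+1).+1)%N; last by lia.
rewrite (facS (n - k.+1)%N) => IH2 IH1.
rewrite (_ : q ^+ n.+1 = q ^+ k.+1 * q ^+ (n - k.+1).+1); last first.
  by rewrite -exprD; congr (_ ^+ _); lia.
move: (q ^+ k.+1) (q ^+ (n - k.+1).+1) IH1 IH2 => x y IH1 IH2.
transitivity ((qbin n k * qfac k * (qfac (n - k.+1) * (1 - y))) * (1 - x) +
  x * (1 - y) * (qbin n k.+1 * (qfac k * (1 - x)) * qfac (n - k.+1))); first by ring.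
by rewrite IH1 IH2; ring.
Qed.

(** The triple product multiplied by z^n, which makes all exponents natural: k - n is the usual
    index j. Induction on n for m = 0, then on m. *)
Lemma jacobi_triple_finite z m n :
  \prod_(i < m) (1 + z * q ^+ i) * \prod_(i < n) (z + q ^+ i.+1) =
  \sum_(k < (m + n).+1) qbin (m + n) k * q ^+ tri k n * z ^+ k.
Proof.
elim: m => [|m IHm].
  rewrite big_ord0 mul1r add0n; elim: n => [|n IHn].
    by rewrite big_ord0 big_ord_recl big_ord0 /= !mulr1 addr0.
  rewrite big_ord_recr IHn /= mulrC mulrDl.
  rewrite [RHS]big_ord_recl /= !qbin0.
  rewrite [X in _ = _ + X](eq_bigr (fun i : 'I_n.+1 => z * (qbin n i * q ^+ tri i n * z ^+ i)
     + q ^+ n.+1 * (qbin n i.+1 * q ^+ tri i.+1 n * z ^+ i.+1))); last first.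
    move=> i _; rewrite /bump leq0n add1n triSS qbinS mulrDl mulrDl.
    have -> : q ^+ n.+1 * (qbin n i.+1 * q ^+ tri i.+1 n * z ^+ i.+1) =
      q ^+ (n + tri i.+1 n).+1 * qbin n i.+1 * z ^+ i.+1.
      by rewrite -addSn exprD; ring.
    by rewrite tri_rec -addSn exprD !(exprS z); ring.
  rewrite big_split /= -!mulr_sumr addrCA; congr (_ + _).
  have -> : \sum_(k < n.+1) qbin n k * q ^+ tri k n * z ^+ k =
            \sum_(k < n.+2) qbin n k * q ^+ tri k n * z ^+ k.
    by rewrite [RHS]big_ord_recr /= qbin_small // !mul0r addr0.
  rewrite big_ord_recl /= !qbin0 mulrDr; congr (_ + _).
  rewrite expr0 !mulr1 !mul1r -exprD; congr (_ ^+ _).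
  by rewrite /tri /= subn0 (binS n.+1) bin1; case: n {IHn} => //=; lia.
rewrite big_ord_recr /= mulrAC IHm addSn; set N := (m + n)%N.
rewrite mulrDr mulr1 [RHS]big_ord_recl /= qbin0.
rewrite [X in _ = _ + X](eq_bigr (fun i : 'I_N.+1 => z * q ^+ m * (qbin N i * q ^+ tri i n * z ^+ i)
     + (qbin N i.+1 * q ^+ tri i.+1 n * z ^+ i.+1))); last first.
  move=> [i /= lti] _; rewrite /bump leq0n add1n qbinS_dual // !mulrDl.
  congr (_ + _); have -> : z * q ^+ m * (qbin N i * q ^+ tri i n * z ^+ i) =
    qbin N i * q ^+ (m + tri i n) * z ^+ i.+1 by rewrite exprD exprS; ring.
  have := tri_rec i n => eqt.
  rewrite (_ : m + tri i n = (N - i) + tri i.+1 n)%N; last by lia.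
  by rewrite exprD; ring.
rewrite big_split /= -mulr_sumr addrCA [RHS]addrC mulrC; congr (_ + _).
rewrite [in LHS]big_ord_recl /= qbin0; congr (_ + _).
by rewrite [RHS]big_ord_recr /= qbin_small // !mul0r addr0.
Qed.

End QBinomial.

Lemma rmorph_qbin (R S : comNzRingType) (f : {rmorphism R -> S}) (q : R) n k :
  f (qbin q n k) = qbin (f q) n k.
Proof.
elim: n k => [|n IHn] [|k]; rewrite ?qbin0 ?rmorph1 ?rmorph0 //.
by rewrite !qbinS rmorphD rmorphM rmorphXn !IHn.
Qed.

(** * Finite forms of the identities of Jacobi, Euler and Gauss *)

Lemma jacobi_cube_finite (R : comNzRingType) (q : R) n :
  qfac q n ^+ 2 = (-1) ^+ n *
    \sum_(k < (n.+1 + n).+1)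
      qbin q (n.+1 + n) k * q ^+ tri k n * ((-1) ^+ k.-1 *+ k).
Proof.
(* Differentiate the triple product at z = -1, a zero of its first factor. *)
have := congr1 (fun p => p^`().[-1]) (jacobi_triple_finite q%:P 'X n.+1 n).
rewrite /= linear_sum horner_sum /= => jtp.
have -> : \sum_(k < (n.+1 + n).+1)
    qbin q (n.+1 + n) k * q ^+ tri k n * ((-1) ^+ k.-1 *+ k) =
  \sum_(k < (n.+1 + n).+1)
    (qbin q%:P (n.+1 + n) k * q%:P ^+ tri k n * 'X ^+ k)^`().[-1].
  apply: eq_bigr => k _.
  rewrite -(rmorph_qbin (polyC : {rmorphism R -> {poly R}})) -polyC_exp -polyCM.
  by rewrite mul_polyC derivZ derivXn hornerZ hornerMn hornerXn.
rewrite -jtp big_ord_recl expr0 mulr1 -mulrA derivM hornerD !hornerM.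
rewrite !hornerD hornerC hornerX subrr mul0r addr0 derivD derivX.
rewrite (derivC 1) add0r hornerC mul1r !horner_prod.
rewrite expr2 mulrCA {1}/qfac; congr (_ * _).
  by apply: eq_bigr => i _; rewrite !(hornerE, horner_exp) mulN1r.
rewrite -[X in (-1) ^+ X]card_ord -prodr_const -big_split /=.
apply: eq_bigr => i _; rewrite !(hornerE, horner_exp) mulN1r; ring.
Qed.

(* With j = k - n, possibly negative, this is j(3j+1)/2. *)
Definition pent (k n : nat) : nat := (3 * tri k n + 2 * k - 2 * n)%N.

Lemma triE (k n : nat) :
  ((2 * tri k n)%N%:Z = (k%:Z - n%:Z) * (k%:Z - n%:Z - 1))%R.
Proof.
have bin2E d : (2 * 'C(d, 2) = d * d.-1)%N by elim: d => [|[|d] IHd] //; rewrite binS bin1 mulnDr IHd /=; lia.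
rewrite /tri; case: leqP => [/subnKC | /ltnW/subnKC] <-; rewrite addKn bin2E.
  by case: (k - n)%N => [|d]; lia.
by case: (n - k)%N => [|d]; lia.
Qed.

Lemma pentE (k n : nat) :
  ((2 * pent k n)%N%:Z = (k%:Z - n%:Z) * (3 * (k%:Z - n%:Z) + 1))%R.
Proof.
have := triE k n; rewrite /pent; set j := k%:Z - n%:Z => tE.
have : 0 <= j * (3 * j + 1) by case: (lerP 0 j) => hj; nia.
lia.
Qed.

Lemma tri_ge (k n : nat) : (n <= (tri k n).+1 + k)%N && (k <= (tri k n).+1 + n)%N.
Proof.
have := triE k n; case: (leqP n k) => [/subnKC | /ltnW/subnKC] <-; nia.
Qed.

Lemma pent_ge (k n : nat) : (n <= pent k n + k)%N && (k <= pent k n + n)%N.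
Proof.
have := pentE k n; case: (leqP n k) => [/subnKC | /ltnW/subnKC] <-; nia.
Qed.

Lemma int_mod5_cases (j : int) : exists a,
  j = 5 * a \/ j = 5 * a + 1 \/ j = 5 * a + 2 \/ j = 5 * a + 3 \/ j = 5 * a + 4.
Proof. by exists (j %/ 5)%Z; lia. Qed.

(** For j = k - n = 0, ..., 4 modulo 5, j(j-1)/2 is 0, 0, 1, 3, 1. The case j = 3 is kept apart
    because Jacobi's coefficient 2j - 1 vanishes there. *)
Lemma tri_mod5 (k n : nat) :
  [|| tri k n %% 5 == 0, tri k n %% 5 == 1 |
      (tri k n %% 5 == 3) && (k == n + 3 %[mod 5])]%N.
Proof.
have := triE k n; have [a] := int_mod5_cases (k%:Z - n%:Z).
by case=> [|[|[|[]]]] E; rewrite E => tE; lia.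
Qed.

(** For j = k - n = 0, ..., 4 modulo 5, j(3j+1)/2 is 0, 2, 2, 0, 1. *)
Lemma pent_mod5 (k n : nat) :
  [|| pent k n %% 5 == 0, pent k n %% 5 == 2 |
      (pent k n %% 5 == 1) && (k.+1 == n %[mod 5])]%N.
Proof.
have := pentE k n; have [a] := int_mod5_cases (k%:Z - n%:Z).
by case=> [|[|[|[]]]] E; rewrite E => tE; lia.
Qed.

(** At j = 5i - 1, j(3j+1)/2 = 1 + 25 i(3i-1)/2. Here i = l - M, and i(3i-1)/2 has pentagonal index
    -i, hence the reflected 2M - l. *)
Lemma pent_dissect (l M : nat) :
  (l <= 2 * M)%N -> (pent (5 * l) (5 * M + 1) = 1 + 25 * pent (2 * M - l) M)%N.
Proof.
move=> lel; have := pentE (5 * l) (5 * M + 1); have := pentE (2 * M - l) M.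
rewrite -subzn //; nia.
Qed.

Lemma qfacS (R : comNzRingType) (q : R) k :
  qfac q k.+1 = qfac q k * (1 - q ^+ k.+1).
Proof. by rewrite /qfac big_ord_recr. Qed.

(** The triple product with base q^3 and z = -q^2 supplies the factors 1 - q^i with i = 1 or 2
    modulo 3, and [qfac (q ^+ 3) n] the others. Taking -q^2 out of each factor z + q^(3i+3) leaves a
    power q^(2n), which is cancelled. *)
Lemma pentagonal_finite (R : idomainType) (q : R) n : q != 0 ->
  qfac q (3 * n) = (-1) ^+ n * (qfac (q ^+ 3) n *
    \sum_(k < (n + n).+1) qbin (q ^+ 3) (n + n) k * q ^+ pent k n * (-1) ^+ k).
Proof.
move=> nzq; have nzqn : q ^+ (2 * n) != 0 by rewrite expf_neq0.
apply: (mulfI nzqn).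
have facE : q ^+ (2 * n) * qfac q (3 * n) = (-1) ^+ n * (qfac (q ^+ 3) n *
    (\prod_(i < n) (1 + - q ^+ 2 * (q ^+ 3) ^+ i) *
     \prod_(i < n) (- q ^+ 2 + (q ^+ 3) ^+ i.+1))).
  elim: n {nzqn} => [|n IHn]; first by rewrite /qfac !muln0 !big_ord0 !mulr1.
  rewrite (_ : 3 * n.+1 = (3 * n).+3)%N; last by lia.
  rewrite (_ : 2 * n.+1 = 2 * n + 2)%N; last by lia.
  rewrite !qfacS !big_ord_recr /= -!exprM exprD.
  transitivity (q ^+ (2 * n) * qfac q (3 * n) * (q ^+ 2 * (1 - q ^+ (3 * n).+1) *
     (1 - q ^+ (3 * n).+2) * (1 - q ^+ (3 * n).+3))); first by ring.
  rewrite IHn (_ : 3 * n.+1 = (3 * n).+3)%N; last by lia.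
  by rewrite !(exprS q (3 * n).+2) !(exprS q (3 * n).+1) !(exprS q (3 * n)) (exprS (-1)); ring.
rewrite facE jacobi_triple_finite [RHS]mulrCA; congr (_ * _).
rewrite [RHS]mulrCA; congr (_ * _); rewrite mulr_sumr; apply: eq_bigr => k _.
rewrite (exprNn (q ^+ 2)) -!exprM.
transitivity (qbin (q ^+ 3) (n + n) k * q ^+ (3 * tri k n + 2 * k) * (-1) ^+ k).
  by rewrite exprD; ring.
rewrite (_ : 3 * tri k n + 2 * k = 2 * n + pent k n)%N ?exprD; first by ring.
have := pentE k n; have := triE k n; rewrite /pent; set j := k%:Z - n%:Z; lia.
Qed.

(** The triple product at z = 1: the first factor is 2, the others form the square of the product of
    the 1 + q^i, which is (q^2;q^2)_n / (q;q)_n. *)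
Lemma gauss_finite (R : comNzRingType) (q : R) n :
  2 * qfac (q ^+ 2) n ^+ 2 = qfac q n ^+ 2 *
    \sum_(k < (n.+1 + n).+1) qbin q (n.+1 + n) k * q ^+ tri k n.
Proof.
have := jacobi_triple_finite q 1 n.+1 n.
under [X in _ = X -> _]eq_bigr do rewrite expr1n mulr1.
move=> <-; rewrite big_ord_recl expr0 mul1r.
have facE : qfac (q ^+ 2) n = qfac q n * \prod_(i < n) (1 + q ^+ i.+1).
  rewrite /qfac -big_split /=; apply: eq_bigr => i _.
  by rewrite -exprM mulnC exprM; ring.
rewrite facE [X in (1 + 1) * X](eq_bigr (fun i : 'I_n => 1 + q ^+ i.+1)); first by ring.
by move=> i _; rewrite mul1r lift0.
Qed.

(** * Euler's product and theta series *)

Definition euler (K : nzRingType) m : fps K := Fps (fun n => (qprod m n)%:~R).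

Section Euler.

Variable K : idomainType.
Local Notation X := (fpsX K).
Local Notation E := (euler K).

Lemma euler_qfac m M N : (0 < m)%N -> (M <= N.+1)%N -> eqfps M (E m) (qfac (X ^+ m) N).
Proof.
move=> m_gt0 leMN; apply: eqfpsW leMN _ => n ltnN.
rewrite /= -(coef_qprod m_gt0 (N := N)) //.
have -> : qfac (X ^+ m) N =
    fps_of_poly (map_poly intr (\prod_(1 <= i < N.+1) (1 - 'X^(m * i)) : {poly int})).
  rewrite big_add1 /= big_mkord !rmorph_prod; apply: eq_bigr => i _.
  by rewrite /= !rmorphB !rmorph1 /= map_polyXn -fpsXn exprM.
by rewrite /= coef_map.
Qed.

Lemma coef0_euler m : E m 0%N = 1.
Proof. by rewrite /= /qprod big_geq // coef1. Qed.

Lemma euler_neq0 m : E m != 0.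
Proof.
apply/eqP => /(congr1 (fun f : fps K => f 0%N))/eqP.
by rewrite coef0_euler coef_fps0 oner_eq0.
Qed.

(** As (q;q)_N / ((q;q)_k (q;q)_(N-k)), the Gaussian binomial tends to 1/(q;q) when k and N - k
    grow; the bounds measure how fast. *)
Lemma euler_qbin m M N k : (0 < m)%N -> (M <= k.+1)%N -> (M + k <= N.+1)%N ->
  eqfps M (E m * qbin (X ^+ m) N k) 1.
Proof.
move=> m_gt0 leMk leMN; have [lt_Nk | lekN] := ltnP N k.
  by rewrite (_ : M = 0)%N //; lia.
apply: (eqfps_mulI (coef0_euler m)); rewrite mulr1.
have Ek := euler_qfac m_gt0 leMk.
have ENk : eqfps M (E m) (qfac (X ^+ m) (N - k)) by apply: euler_qfac => //; lia.
have EN : eqfps M (E m) (qfac (X ^+ m) N) by apply: euler_qfac => //; lia.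
apply: eqfps_trans (eqfps_sym EN); rewrite -(qbin_fac (X ^+ m) lekN).
rewrite -mulrA [X in eqfps _ _ X]mulrC -mulrA [X in eqfps _ X _]mulrA.
rewrite -[X in eqfps _ X _]mulrA; apply: eqfpsM => //.
by apply: eqfpsM.
Qed.

(** The factor X^(t k) lowers to M - t k the precision needed of the binomial, so the extreme k,
    where it is far from its limit, do no harm. *)
Lemma euler_qbin_sum m M N (t : nat -> nat) (c : nat -> fps K) : (0 < m)%N ->
    (forall k, (k <= N)%N -> (M <= (t k + k).+1)%N && (M + k <= (t k + N).+1)%N) ->
  eqfps M (E m * \sum_(k < N.+1) qbin (X ^+ m) N k * X ^+ t k * c k)
          (\sum_(k < N.+1) X ^+ t k * c k).
Proof.
move=> m_gt0 tP; rewrite mulr_sumr; apply: eqfps_sum => -[k /= ltkN] _.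
have /andP[tP1 tP2] := tP k ltkN.
have -> : E m * (qbin (X ^+ m) N k * X ^+ t k * c k) =
  X ^+ t k * (E m * qbin (X ^+ m) N k) * c k by ring.
apply: eqfpsM => //; apply: (eqfpsW (N := t k + (M - t k))); first by lia.
rewrite -[X in eqfps _ _ X]mulr1; apply/eqfps_shift/euler_qbin => //; lia.
Qed.

(** The bilateral series over j is kept as a finite sum over k = n + j, valid modulo X^n. *)
Lemma pentagonal_series m n : (0 < m)%N ->
  eqfps n (E m)
    ((-1) ^+ n * \sum_(k < (n + n).+1) X ^+ (m * pent k n) * (-1) ^+ k).
Proof.
move=> m_gt0; have nzq : X ^+ m != 0 by rewrite expf_neq0 ?fpsX_neq0.
apply: (@eqfps_trans _ _ _ (qfac (X ^+ m) (3 * n))).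
  by apply: euler_qfac => //; lia.
rewrite (pentagonal_finite n nzq); apply: eqfpsM => //.
apply: (@eqfps_trans _ _ _ (E (m * 3) * \sum_(k < (n + n).+1)
    qbin (X ^+ (m * 3)) (n + n) k * X ^+ (m * pent k n) * (-1) ^+ k)).
  rewrite -exprM; apply: eqfpsM; last first.
    by rewrite (eq_bigr _ (fun _ _ => congr1 (fun x => _ * x * _) (exprM _ _ _))).
  by apply/eqfps_sym/euler_qfac; lia.
apply: (@euler_qbin_sum _ _ _ (fun k => m * pent k n)%N (fun k => (-1) ^+ k)).
  by rewrite muln_gt0 m_gt0.
move=> k lek; have := pent_ge k n.
have := leq_pmull (pent k n) m_gt0; lia.
Qed.

Lemma gauss_series m n : (0 < m)%N ->
  eqfps n (2 * E (2 * m) ^+ 2)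
    (E m * \sum_(k < (n.+1 + n).+1) X ^+ (m * tri k n)).
Proof.
move=> m_gt0; apply: (@eqfps_trans _ _ _ (2 * qfac (X ^+ (2 * m)) n ^+ 2)).
  by apply: eqfpsM => //; apply: eqfpsX; apply: euler_qfac; lia.
rewrite mulnC exprM gauss_finite expr2 -mulrA.
apply: eqfpsM; first by apply/eqfps_sym/euler_qfac.
apply: (@eqfps_trans _ _ _ (E m * \sum_(k < (n.+1 + n).+1)
    qbin (X ^+ m) (n.+1 + n) k * X ^+ (m * tri k n) * 1)).
  apply: eqfpsM; first by apply/eqfps_sym/euler_qfac.
  by under [X in eqfps _ _ X]eq_bigr do rewrite mulr1 exprM.
under [X in eqfps _ _ X]eq_bigr do rewrite -[X ^+ _]mulr1.
apply: (@euler_qbin_sum _ _ _ (fun k => m * tri k n)%N (fun k => 1)) => //.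
move=> k lek; have := tri_ge k n.
have := leq_pmull (tri k n) m_gt0; lia.
Qed.

Lemma jacobi_cube_series m n : (0 < m)%N ->
  eqfps n (E m ^+ 3) ((-1) ^+ n *
    \sum_(k < (n.+1 + n).+1) X ^+ (m * tri k n) * ((-1) ^+ k.-1 *+ k)).
Proof.
move=> m_gt0.
apply: (@eqfps_trans _ _ _ (E m * qfac (X ^+ m) n ^+ 2)).
  by rewrite exprS; apply: eqfpsM => //; apply: eqfpsX; apply: euler_qfac.
rewrite jacobi_cube_finite mulrCA; apply: eqfpsM => //.
under eq_bigr do rewrite -exprM.
apply: (@euler_qbin_sum _ _ _ (fun k => m * tri k n)%N
  (fun k => (-1) ^+ k.-1 *+ k)) => //.
move=> k lek; have := tri_ge k n.
have := leq_pmull (tri k n) m_gt0; lia.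
Qed.

End Euler.

(** * Dissection by residues modulo 5 *)

Section Dissection.

Variable K : comNzRingType.
Implicit Types f g : fps K.

(** Exponents are not rescaled, so the parts multiply as in a ring graded by Z/5. *)
Definition res5 r f := Fps (fun n => if n == r %[mod 5] then f n else 0).

Lemma coef_res5 r f n : res5 r f n = if n == r %[mod 5] then f n else 0.
Proof. by []. Qed.

Lemma res5_eq0 r f : (forall n, n = r %[mod 5] -> f n = 0) -> res5 r f = 0.
Proof. by move=> f0; apply: fpsP => n; rewrite coef_res5; case: eqP => // /f0. Qed.

Lemma res5_sum f : f = res5 0 f + res5 1 f + res5 2 f + res5 3 f + res5 4 f.
Proof.
apply: fpsP => n; rewrite !coef_fpsD !coef_res5.
have := ltn_pmod n (isT : 0 < 5)%N.
by move: (n %% 5)%N => -[|[|[|[|[|]]]]] //= _; rewrite ?addr0 ?add0r.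
Qed.

Lemma res5_res5M i r f g : (i < 5)%N ->
  res5 r (res5 i f * g) = res5 i f * res5 (r + (5 - i)) g.
Proof.
move=> lti5; apply: fpsP => n; rewrite coef_res5 !coef_fpsM.
case: (eqVneq (n %% 5) (r %% 5))%N => [eqnr | neqnr].
  apply: eq_bigr => -[k /= ltk] _.
  by case: eqP => eqk; rewrite ?mul0r // ifT //; lia.
rewrite big1 // => -[k /= ltk] _.
by case: eqP => eqk; rewrite ?mul0r // ifF ?mulr0 //; lia.
Qed.

Lemma res5M_sum r f g : res5 r (f * g) =
  res5 0 f * res5 (r + 5) g + res5 1 f * res5 (r + 4) g + res5 2 f * res5 (r + 3) g
  + res5 3 f * res5 (r + 2) g + res5 4 f * res5 (r + 1) g.
Proof.
have res5D h k : res5 r (h + k) = res5 r h + res5 r k.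
  by apply: fpsP => n; rewrite coef_fpsD !coef_res5; case: ifP; rewrite ?addr0.
by rewrite {1}[f]res5_sum !mulrDl !res5D !res5_res5M.
Qed.

Lemma res5D5 r f : res5 (r + 5) f = res5 r f.
Proof. by apply: fpsP => n; rewrite !coef_res5 modnDr. Qed.

Lemma res5M0 f g : res5 0 (f * g) = res5 0 f * res5 0 g + res5 1 f * res5 4 g
  + res5 2 f * res5 3 g + res5 3 f * res5 2 g + res5 4 f * res5 1 g.
Proof. by rewrite res5M_sum (res5D5 0). Qed.
Lemma res5M1 f g : res5 1 (f * g) = res5 0 f * res5 1 g + res5 1 f * res5 0 g
  + res5 2 f * res5 4 g + res5 3 f * res5 3 g + res5 4 f * res5 2 g.
Proof. by rewrite res5M_sum (res5D5 1) (res5D5 0). Qed.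
Lemma res5M2 f g : res5 2 (f * g) = res5 0 f * res5 2 g + res5 1 f * res5 1 g
  + res5 2 f * res5 0 g + res5 3 f * res5 4 g + res5 4 f * res5 3 g.
Proof. by rewrite res5M_sum (res5D5 2) (res5D5 1) (res5D5 0). Qed.
Lemma res5M3 f g : res5 3 (f * g) = res5 0 f * res5 3 g + res5 1 f * res5 2 g
  + res5 2 f * res5 1 g + res5 3 f * res5 0 g + res5 4 f * res5 4 g.
Proof. by rewrite res5M_sum (res5D5 3) (res5D5 2) (res5D5 1) (res5D5 0). Qed.
Lemma res5M4 f g : res5 4 (f * g) = res5 0 f * res5 4 g + res5 1 f * res5 3 g
  + res5 2 f * res5 2 g + res5 3 f * res5 1 g + res5 4 f * res5 0 g.
Proof.
by rewrite res5M_sum (res5D5 4) (res5D5 3) (res5D5 2) (res5D5 1) (res5D5 0).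
Qed.
Definition res5M := (res5M0, res5M1, res5M2, res5M3, res5M4).

Lemma coef_sign_fpsM k f n : ((-1) ^+ k * f) n = (-1) ^+ k * f n.
Proof. by rewrite -signr_odd -(signr_odd K); case: odd; rewrite ?mulN1r ?mul1r. Qed.

Lemma coef_sign_monomial a k l n :
  (fpsX K ^+ a * ((-1) ^+ k *+ l)) n = (n == a)%:R * ((-1) ^+ k *+ l).
Proof. by rewrite -mulr_natr mulrCA coef_sign_fpsM mulr_natr coef_fpsMn coef_fpsXn; ring. Qed.

End Dissection.

Lemma sum_multiples5 (V : nmodType) (F : nat -> V) L :
    (forall k, (k %% 5 != 0)%N -> F k = 0) ->
  \sum_(k < 5 * L + 3) F k = \sum_(l < L.+1) F (5 * l)%N.
Proof.
move=> F0; elim: L => [|L IHL].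
  by rewrite !big_ord_recr !big_ord0 /= (F0 1%N) ?(F0 2%N) // !addr0.
rewrite [RHS]big_ord_recr /= -IHL (_ : 5 * L.+1 + 3 = (5 * L + 3).+4.+1)%N; last by lia.
rewrite !(@big_ord_recr _ _ _ (_ + _)%N, @big_ord_recr _ _ _ _.+1) /=.
rewrite (_ : 5 * L.+1 = (5 * L + 3).+2)%N; last by lia.
do 4!rewrite ?(F0 (5 * L + 3)%N) ?(F0 (5 * L + 3).+1) ?(F0 (5 * L + 3).+3)
  ?(F0 (5 * L + 3).+4); try lia.
by rewrite !addr0.
Qed.

Section EulerDissection.

Variable K : idomainType.
Local Notation X := (fpsX K).
Local Notation E := (euler K).

Lemma coef_euler m N n : (0 < m)%N -> (n < N)%N ->
  E m n = (-1) ^+ N * \sum_(k < (N + N).+1) (n == m * pent k N)%N%:R * (-1) ^+ k.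
Proof.
move=> m_gt0 /(pentagonal_series K m_gt0)->.
rewrite coef_sign_fpsM coef_fps_sum; congr (_ * _); apply: eq_bigr => k _.
exact: coef_sign_monomial K _ _ 1 _.
Qed.

Lemma euler_coef_eq0 m n : (0 < m)%N ->
  (forall t, t %% 5 \in [:: 0; 1; 2]%N -> n <> m * t %[mod 5])%N -> E m n = 0.
Proof.
move=> m_gt0 nP; rewrite (coef_euler m_gt0 (ltnSn n)) big1 ?mulr0 // => k _.
case: eqP => [eqn | _]; last by rewrite mul0r.
have := pent_mod5 k n.+1 => /or3P tP; case: (nP (pent k n.+1)); last by rewrite -eqn.
by rewrite !inE; case: tP => [-> | -> | /andP[-> _]]; rewrite ?orbT.
Qed.

(** An exponent m j(3j+1)/2 is m modulo 5 only if j = 5i - 1. By [pent_dissect] these terms form X^m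
    times the series of (q^(25m); q^(25m)), and (-1)^j = -(-1)^i gives the sign. *)
Lemma res5_euler m : (0 < m < 5)%N -> res5 m (E m) = - (X ^+ m * E (25 * m)).
Proof.
case/andP=> m_gt0 ltm5; apply: fpsP => n; rewrite coef_res5 coef_fpsN coef_fpsXnM.
case: eqP => [eqnm | neqnm]; last first.
  case: ltnP => [|lemn]; first by rewrite oppr0.
  rewrite (coef_euler (m := 25 * m) (N := n.+1)) ?muln_gt0 //; last by lia.
  rewrite big1 ?mulr0 ?oppr0 // => k _; case: eqP; rewrite ?mul0r //; lia.
have lemn : (m <= n)%N by lia.
rewrite ifF; last by lia.
(* With order 5n + 1, the condition j = -1 modulo 5 becomes k = 0 modulo 5. *)
rewrite (coef_euler (N := 5 * n + 1) m_gt0); last by lia.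
rewrite (coef_euler (m := 25 * m) (N := n)) ?muln_gt0 //; last by lia.
rewrite (_ : (5 * n + 1 + (5 * n + 1)).+1 = 5 * (n + n) + 3)%N; last by lia.
pose F k : K := (n == m * pent k (5 * n + 1))%N%:R * (-1) ^+ k.
rewrite (sum_multiples5 (F := F)); last first.
  move=> k nzk; rewrite /F; case: eqP; rewrite ?mul0r // => eqn.
  have := pent_mod5 k (5 * n + 1); move: (pent _ _) eqn => t eqn tP.
  exfalso; clear F; case: m m_gt0 ltm5 eqnm lemn eqn => [|[|[|[|[|m]]]]] //=; lia.
rewrite [in RHS](reindex_inj rev_ord_inj) /= -mulNr.
have -> : (-1) ^+ (5 * n + 1) = - (-1) ^+ n :> K.
  by rewrite addn1 exprS mulN1r -signr_odd oddM signr_odd.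
congr (_ * _); apply: eq_bigr => -[l /= ltl] _; rewrite /F pent_dissect; last by lia.
rewrite subSS mul2n -addnn -signr_odd oddM /= -(signr_odd _ (_ - _)) oddB; last by lia.
rewrite addnn odd_double /=; congr (_ %:R * _); apply/eqP/eqP; lia.
Qed.

End EulerDissection.

(** * Coefficients modulo 5 *)

Lemma F5_exp5 (a : 'F_5) : a ^+ 5 = a.
Proof. by rewrite -[RHS]expf_card card_Fp. Qed.

Lemma five_eq0 : 5%:R = 0 :> fps 'F_5.
Proof. by apply: fpsP => n; rewrite coef_fpsMn; apply/mulrn_pchar/pchar_Fp. Qed.

Lemma poly_exp5 (p : {poly 'F_5}) : p ^+ 5 = p \Po 'X^5.
Proof.
have ch5 : 5%N \in [pchar {poly 'F_5}] by rewrite pchar_poly pchar_Fp.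
rewrite comp_polyE -{1}[p]coefK poly_def -(pFrobenius_autE ch5) rmorph_sum.
by apply: eq_bigr => i _; rewrite /= pFrobenius_autE exprZn F5_exp5 exprAC.
Qed.

(** Frobenius fixes F_5, so f^5 = f(q^5). *)
Lemma coef_fps_exp5 (f : fps 'F_5) n :
  (f ^+ 5) n = if (5 %| n)%N then f (n %/ 5)%N else 0.
Proof.
have := eqfpsX 5 (@eqfps_trunc _ n.+1 f) (ltnSn n); rewrite -rmorphXn /= poly_exp5.
rewrite coef_comp_poly_Xn // coef_fps_trunc => ->; rewrite ltnS leq_div //.
Qed.

Lemma euler_exp5 m : (0 < m)%N -> euler 'F_5 m ^+ 5 = euler 'F_5 (5 * m).
Proof.
move=> m_gt0; apply: eqfps_all => N.
have E5 : eqfps N (euler 'F_5 (5 * m)) (qfac (fpsX 'F_5 ^+ (5 * m)) N).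
  by apply: euler_qfac => //; lia.
apply: eqfps_trans (eqfps_sym E5); rewrite mulnC exprM.
have := eqfpsX 5 (euler_qfac 'F_5 m_gt0 (leqnSn N)); congr (eqfps _ _ _).
have ch5 : 5%N \in [pchar (fps 'F_5)] by rewrite inE five_eq0 eqxx.
rewrite /qfac -prodrXl; apply: eq_bigr => i _.
rewrite -(pFrobenius_autE ch5) rmorphB rmorph1 /= pFrobenius_autE -!exprM.
by congr (1 - _ ^+ _); lia.
Qed.

(** By Jacobi the exponents are m times triangular numbers, and a triangular number other than 0 or
    1 modulo 5 carries a coefficient divisible by 5. *)
Lemma res5_euler_cube m r : (0 < m)%N -> r != 0 %[mod 5] -> r != m %[mod 5] ->
  res5 r (euler 'F_5 m ^+ 3) = 0.
Proof.
(* The terms j and 1 - j have coefficients N + j and N + 1 - j with opposite signs; only together do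
   they make 2j - 1. Taking N = 2 modulo 5 makes each vanish by itself when j = 3 modulo 5. *)
move=> m_gt0 nr0 nrm; apply: res5_eq0 => n eqnr; set N := (5 * n + 7)%N.
rewrite (@jacobi_cube_series _ m N) //; last by lia.
rewrite coef_sign_fpsM coef_fps_sum big1 ?mulr0 // => k _.
rewrite coef_sign_monomial; case: eqP => [eqn | _]; last by rewrite mul0r.
have := tri_mod5 k N => /or3P[/eqP t0 | /eqP t1 | /andP[_ /eqP kN]].
- by case/eqP: nr0; rewrite -eqnr eqn -modnMmr t0 muln0.
- by case/eqP: nrm; rewrite -eqnr eqn -modnMmr t1 muln1.
have /dvdnP[l ->] : (5 %| k)%N by rewrite /N in kN; lia.
by rewrite mulrnA -(mulr_natr _ 5) (_ : 5%:R = 0) ?mulr0 //; apply/eqP.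
Qed.

Definition cubic_fps : fps 'F_5 := Fps (fun n => (cubic_partitions n)%:~R).

Lemma cubic_fpsE : euler 'F_5 1 * euler 'F_5 2 * cubic_fps = 1.
Proof.
apply: fpsP => n; have := congr1 (fun z : int => z%:~R : 'F_5) (cubic_partitions_gf n).
rewrite /ps_mul /ps_one rmorph_sum coef_fps1 rmorph_nat => <-; apply: eq_bigr => i _.
rewrite rmorphM rmorph_sum; congr (_ * _); apply: eq_bigr => j _.
by rewrite rmorphM.
Qed.

(** P is Gauss's psi = f^2/e, and no triangular number is 2 or 4 modulo 5. The bilateral sum gives 2
    psi, and 2 is invertible. *)
Lemma gauss_psi : exists P : fps 'F_5,
  [/\ euler 'F_5 1 * P = euler 'F_5 2 ^+ 2, res5 2 P = 0 & res5 4 P = 0].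
Proof.
pose P := cubic_fps * euler 'F_5 2 ^+ 3; exists P.
have EP : euler 'F_5 1 * P = euler 'F_5 2 ^+ 2.
  by rewrite -[RHS]mul1r -cubic_fpsE /P; ring.
have P0 n : (forall t, (t %% 5 \in [:: 0; 1; 3])%N -> n <> t %[mod 5]) -> P n = 0.
  move=> nP; have : (2 * P) n = 0.
    have E0 := coef0_euler 'F_5 1.
    have := @gauss_series 'F_5 1 n.+1 isT; rewrite muln1 -EP mulrCA.
    move=> /(eqfps_mulI E0)/(_ n (ltnSn n)) ->; rewrite coef_fps_sum big1 // => k _.
    rewrite mul1n coef_fpsXn; case: eqP => // eqn.
    case: (nP (tri k n.+1)); last by rewrite -eqn.
    by have := tri_mod5 k n.+1; rewrite !inE => /or3P[-> | -> | /andP[-> _]]; rewrite ?orbT.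
  rewrite mulr_natl coef_fpsMn -mulr_natl => /eqP; rewrite mulf_eq0 => /orP[//|/eqP //].
by split=> //; apply: res5_eq0 => n n_r; apply: P0 => t; rewrite n_r !inE => /or3P[] /eqP ->.
Qed.

(** * The level 10 function field *)

(* The part of (a + b + c)^4 of weight r modulo 5, where a, b, c have weights
   0, 1, 2. *)
Definition quartic_part (R : comNzRingType) r (a b c : R) : R :=
  match r with
  | 0 => a ^+ 4 + 12 * a * b * c ^+ 2 + 4 * b ^+ 3 * c
  | 1 => 4 * a ^+ 3 * b + 4 * a * c ^+ 3 + 6 * b ^+ 2 * c ^+ 2
  | 2 => 6 * a ^+ 2 * b ^+ 2 + 4 * a ^+ 3 * c + 4 * b * c ^+ 3
  | 3 => 4 * a * b ^+ 3 + 12 * a ^+ 2 * b * c + c ^+ 4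
  | _ => b ^+ 4 + 12 * a * b ^+ 2 * c + 6 * a ^+ 2 * c ^+ 2
  end.

(* The part of (a0 + a1 + a2)^4 (b0 + b1 + b2)^4 of weight 2 modulo 5, where
   b0, b1, b2 have weights 0, 2, 4. *)
Definition octic_part (R : comNzRingType) (a0 a1 a2 b0 b1 b2 : R) : R :=
  quartic_part 0 a0 a1 a2 * quartic_part 1 b0 b1 b2 +
  quartic_part 1 a0 a1 a2 * quartic_part 3 b0 b1 b2 +
  quartic_part 2 a0 a1 a2 * quartic_part 0 b0 b1 b2 +
  quartic_part 3 a0 a1 a2 * quartic_part 2 b0 b1 b2 +
  quartic_part 4 a0 a1 a2 * quartic_part 4 b0 b1 b2.

(** The three equations are the parts of e psi = f^2 with residues 0, 3 and 1, written with a2 =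
    -a1/x, b2 = -b1/y and p3 = -b1^2/a1. The first two give p0 and p1; the third then becomes the
    factored relation. Its second factor, divided by -x^2, is the conclusion. *)
Lemma psi_relation (L : fieldType) (x y a1 b1 p0 p1 : L) :
    x != 0 -> y != 0 -> a1 != 0 -> b1 != 0 -> y != x ^+ 2 ->
    x * a1 * p0 + b1 ^+ 2 / x = (y * b1) ^+ 2 ->
    - (a1 / x) * p1 - x * b1 ^+ 2 = (b1 / y) ^+ 2 ->
    x * a1 * p1 + a1 * p0 = - 2 * b1 ^+ 2 / y ->
  y / x ^+ 2 * (1 - x * y ^+ 2) = 1 + x * y ^+ 2.
Proof.
move=> x0 y0 a0 b0 neq h0 h3 h1.
have Dp0 : p0 = ((y * b1) ^+ 2 - b1 ^+ 2 / x) / (x * a1) by rewrite -h0; field; rewrite ?x0 ?y0 ?a0.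
have Dp1 : p1 = - ((b1 / y) ^+ 2 + x * b1 ^+ 2) * x / a1 by rewrite -h3; field; rewrite ?x0 ?y0 ?a0.
have : (y - x ^+ 2) * (x ^+ 3 * y ^+ 2 + x * y ^+ 3 + x ^+ 2 - y) = 0.
  apply: (mulfI (_ : b1 ^+ 2 != 0)); first by rewrite expf_neq0.
  rewrite mulr0; transitivity (x ^+ 2 * y ^+ 2 * (x * a1 * p1 + a1 * p0
    - (- 2 * b1 ^+ 2 / y))); last by rewrite h1 subrr mulr0.
  by rewrite Dp0 Dp1; field; rewrite ?x0 ?y0 ?a0.
move/eqP; rewrite mulf_eq0 subr_eq0 (negPf neq) /= => /eqP M.
apply/eqP; rewrite -subr_eq0; apply/eqP.
transitivity (- (x ^+ 3 * y ^+ 2 + x * y ^+ 3 + x ^+ 2 - y) / x ^+ 2).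
  by field; rewrite ?x0 ?y0 ?a0.
by rewrite M oppr0 mul0r.
Qed.

(* The rational functions of x and u below are invariant under multiplying x by
   a fifth root of unity, hence rational in u and t = u^2 x^5. *)
Lemma octic_part_param (L : fieldType) (five0 : 5%:R = 0 :> L) (x u t a1 b1 : L) :
    x != 0 -> u != 0 -> a1 != 0 -> b1 != 0 ->
    t = u ^+ 2 * x ^+ 5 -> u * (1 - t) = 1 + t ->
  let rho := (t ^+ 2 - t - 1) ^+ 2 / (t * (1 - t) * (1 + t)) in
  octic_part (x * a1) a1 (- a1 / x) (u * x ^+ 2 * b1) b1 (- b1 / (u * x ^+ 2)) =
    - 2 * rho ^+ 2 * (a1 * b1) ^+ 4 /\
  ((x * a1) ^+ 5 + a1 ^+ 5 + (- a1 / x) ^+ 5) *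
    ((u * x ^+ 2 * b1) ^+ 5 + b1 ^+ 5 + (- b1 / (u * x ^+ 2)) ^+ 5) =
    rho ^+ 3 * (a1 * b1) ^+ 5.
Proof.
move=> x0 u0 a0 b0 Dt ut rho.
have t0 : t != 0 by rewrite Dt mulf_neq0 ?expf_neq0.
have two0 : 2%:R != 0 :> L.
  apply/eqP => two0; have : 1 = 5%:R - 2%:R * 2%:R :> L by ring.
  by rewrite five0 two0 mulr0 subr0 => /eqP; rewrite oner_eq0.
have nt1 : 1 - t != 0.
  apply/eqP => t1; have : 2%:R = (1 - t) + (1 + t) by ring.
  by rewrite -ut t1 mulr0 addr0 => /eqP; rewrite (negPf two0).
have ntm1 : 1 + t != 0.
  by rewrite -ut mulf_neq0.
have Du : u = (1 + t) / (1 - t) by rewrite -ut mulfK.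
split.
  transitivity ((a1 * b1) ^+ 4 * (4 * t ^+ 2 / u + 2 / u ^+ 2 - 32 * t / u
    + 4 / (t * u ^+ 2) + 2 * t ^+ 2 + 16 / u - 16 * t + 32 / (t * u) + 25
    + 32 * t * u + 16 / t - 16 * u + 2 / t ^+ 2 - 4 * t * u ^+ 2 - 32 * u / t
    + 2 * u ^+ 2 - 4 * u / t ^+ 2)).
    by rewrite Dt /octic_part /quartic_part; field; rewrite ?x0 ?u0.
  (* The two sides agree only in characteristic 5. Adding 5 times an explicit fraction gives an
     identity of rational functions over the integers, within reach of [field]. *)
  rewrite Du; transitivity (- 2 * rho ^+ 2 * (a1 * b1) ^+ 4 + 5%:R * ((a1 * b1) ^+ 4
    * (4 * t - 23 * t ^+ 2 - 20 * t ^+ 3 + 40 * t ^+ 4 + 20 * t ^+ 5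
       - 23 * t ^+ 6 - 4 * t ^+ 7) / (t * (1 - t) * (1 + t)) ^+ 2)).
    by rewrite /rho; field; rewrite ?t0 ?nt1 ?ntm1.
  by rewrite five0 mul0r addr0.
set h := t ^+ 2 - t - 1.
(* Here x^5 = t / u^2 and y^5 = (u x^2)^5 = t^2 u. *)
transitivity ((a1 * b1) ^+ 5 * ((t / u ^+ 2 + 1 - u ^+ 2 / t)
   * (t ^+ 2 * u + 1 - (t ^+ 2 * u)^-1))).
  by rewrite Dt; field; rewrite ?x0 ?u0.
(* Modulo 5 both numerators are h^3, and the denominators multiply to the cube of t (1 - t)(1 + t):
   the product is rho^3. *)
have -> : t / u ^+ 2 + 1 - u ^+ 2 / t = h ^+ 3 / (t * (1 - t) ^+ 2 * (1 + t) ^+ 2)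
  + 5%:R * ((- t ^+ 2 - 3 * t ^+ 3 + t ^+ 4) / (t * (1 - t) ^+ 2 * (1 + t) ^+ 2)).
  by rewrite Du /h; field; rewrite ?t0 ?nt1 ?ntm1.
have -> : t ^+ 2 * u + 1 - (t ^+ 2 * u)^-1 = h ^+ 3 / (t ^+ 2 * (1 - t) * (1 + t))
  + 5%:R * ((t - t ^+ 3 + t ^+ 5) / (t ^+ 2 * (1 - t) * (1 + t))).
  by rewrite Du /h; field; rewrite ?t0 ?nt1 ?ntm1.
by rewrite five0 !mul0r !addr0 /rho /h; field; rewrite ?t0 ?nt1 ?ntm1.
Qed.

(* -3 is not a square modulo 5, so the form F^2 + FG + G^2 is anisotropic. *)
Lemma fps_F5_anisotropic (f g : fps 'F_5) : f ^+ 2 + f * g + g ^+ 2 = 0 -> f = 0.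
Proof.
have F5_anisotropic (a b : 'F_5) : a ^+ 2 + a * b + b ^+ 2 = 0 -> a = 0 /\ b = 0.
  move=> /eqP ab0; have : (a == 0) && (b == 0).
    by move: b ab0; move: a; by do 2![case=> [[|[|[|[|[|?]]]]] ?] //].
  by case/andP=> /eqP-> /eqP->.
move=> fg0; apply: fpsP => n; rewrite coef_fps0; elim: n f g fg0 => [|n IHn] f g fg0.
all: have := congr1 (fun h : fps 'F_5 => h 0%N) fg0.
all: rewrite !coef_fpsD coef0_fpsM coef0_fpsM coef0_fpsM => /F5_anisotropic[f0 g0] //.
(* Descent: X divides both series, and the quotients satisfy the same equation. *)
have [[f' Df] [g' Dg]] := (fps_eqX f0, fps_eqX g0).
rewrite Df -[fpsX _]expr1 coef_fpsXnM /= subn1; apply: (IHn f' g').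
have nzX : fpsX 'F_5 ^+ 2 != 0 by rewrite expf_neq0 ?fpsX_neq0.
by apply: (mulfI nzX); rewrite mulr0 -fg0 Df Dg; ring.
Qed.

Lemma fractionP (R : idomainType) (z : {fraction R}) :
  exists n d, d != 0 /\ z = tofrac n / tofrac d.
Proof.
elim/quotW: z => r; exists (frac r).1, (frac r).2.
have nzd : (frac r).2 != 0 by apply: denom_ratioP.
split=> //; apply: (canRL (mulfK _)); first by rewrite tofrac_eq0.
rewrite -[LHS]/(FracField.mul _ _) !piE; apply/eqmodP.
by rewrite /= FracField.equivfE !numden_Ratio ?mulr1 ?oner_eq0 // mulrC.
Qed.

(** For z = f/g, f^3 - g^3 = (f - g)(f^2 + f g + g^2), and the second factor is anisotropic. *)
Lemma frac_cube_root1 (z : {fraction fps 'F_5}) : z ^+ 3 = 1 -> z = 1.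
Proof.
have [f [g [nzg ->]]] := fractionP z.
have nzgF : tofrac g != 0 by rewrite tofrac_eq0.
rewrite expr_div_n => /(canRL (mulfVK (expf_neq0 _ nzgF))); rewrite mul1r -!tofracXn.
move/eqP; rewrite tofrac_eq => /eqP fg3.
have /eqP : (f - g) * (f ^+ 2 + f * g + g ^+ 2) = 0.
  by transitivity (f ^+ 3 - g ^+ 3); [ring | rewrite fg3 subrr].
rewrite mulf_eq0 subr_eq0 => /orP[/eqP-> | /eqP fg0]; first by rewrite divff.
by case/eqP: nzg; apply: (@fps_F5_anisotropic _ f); rewrite -fg0; ring.
Qed.

(** The field-theoretic core: the a, b and p stand for the parts of e, f and psi, the last four
    equations for the parts of e psi = f^2 with residues 0, 1, 3, 4. The inequality says y !=
    x^2. *)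
Lemma dissection_identity (L : fieldType) (five0 : 5%:R = 0 :> L)
    (a0 a1 a2 b0 b1 b2 p0 p1 p3 : L) :
    a0 != 0 -> a1 != 0 -> b0 != 0 -> b1 != 0 ->
    a0 * a2 = - a1 ^+ 2 -> b0 * b2 = - b1 ^+ 2 ->
    b0 * a1 ^+ 2 != a0 ^+ 2 * b1 ->
    a0 * p0 + a2 * p3 = b0 ^+ 2 -> a0 * p1 + a1 * p0 = 2 * b1 * b2 ->
    a0 * p3 + a2 * p1 = b2 ^+ 2 -> a1 * p3 = 2 * b0 * b2 + b1 ^+ 2 ->
  exists rho,
    octic_part a0 a1 a2 b0 b1 b2 = - 2 * rho ^+ 2 * (a1 * b1) ^+ 4 /\
    (a0 ^+ 5 + a1 ^+ 5 + a2 ^+ 5) * (b0 ^+ 5 + b1 ^+ 5 + b2 ^+ 5) =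
      rho ^+ 3 * (a1 * b1) ^+ 5.
Proof.
move=> nza0 nza1 nzb0 nzb1 Ha Hb nondeg E0 E1 E3 E4.
pose x := a0 / a1; pose y := b0 / b1; pose u := y / x ^+ 2; pose t := x * y ^+ 2.
have nzx : x != 0 by rewrite mulf_neq0 ?invr_eq0.
have nzy : y != 0 by rewrite mulf_neq0 ?invr_eq0.
have nzu : u != 0 by rewrite mulf_neq0 ?invr_eq0 ?expf_neq0.
have Da0 : a0 = x * a1 by rewrite divfK.
have Dy : y = u * x ^+ 2 by rewrite divfK ?expf_neq0.
have Db0 : b0 = y * b1 by rewrite divfK.
have Da2 : a2 = - a1 / x.
  by apply: (mulfI nza0); rewrite Ha Da0; field; rewrite ?nzx.
have Db2 : b2 = - b1 / y.
  by apply: (mulfI nzb0); rewrite Hb Db0; field; rewrite ?nzy.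
have Dp3 : p3 = - b1 ^+ 2 / a1.
  by apply: (mulfI nza1); rewrite E4 -mulrA Hb; field; rewrite ?nza1.
have ut : u * (1 - t) = 1 + t.
  apply: (@psi_relation _ x y a1 b1 p0 p1) => //.
  - apply: contraNneq nondeg => Exy; rewrite Da0 Db0 Exy; apply/eqP; ring.
  - by rewrite -Db0 -E0 Da2 Dp3 -Da0; field; rewrite ?nzx ?nza1.
  - transitivity (b2 ^+ 2); last by rewrite Db2; field; rewrite ?nzy.
    by rewrite -E3 Da2 Dp3 {1}Da0; field; rewrite ?nzx ?nza1.
  - by rewrite -Da0 E1 Db2; field; rewrite ?nzy.
exists ((t ^+ 2 - t - 1) ^+ 2 / (t * (1 - t) * (1 + t))).
rewrite Da2 Db2 Da0 Db0 Dy; apply: octic_part_param => //.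
by rewrite /t Dy; ring.
Qed.

(** * Dissection of fourth powers *)

Section Quartic.

Variables (K : comNzRingType) (g : fps K).

Lemma res5_exp4_012 : res5 3 g = 0 -> res5 4 g = 0 ->
  forall r, (r < 5)%N ->
  res5 r (g ^+ 4) = quartic_part r (res5 0 g) (res5 1 g) (res5 2 g).
Proof.
move=> g3 g4; set a := res5 0 g; set b := res5 1 g; set c := res5 2 g.
have s0 : res5 0 (g ^+ 2) = a ^+ 2 by rewrite expr2 res5M g3 g4 -?/a -?/b -?/c; ring.
have s1 : res5 1 (g ^+ 2) = 2 * a * b by rewrite expr2 res5M g3 g4 -?/a -?/b -?/c; ring.
have s2 : res5 2 (g ^+ 2) = b ^+ 2 + 2 * a * c by rewrite expr2 res5M g3 g4 -?/a -?/b -?/c; ring.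
have s3 : res5 3 (g ^+ 2) = 2 * b * c by rewrite expr2 res5M g3 g4 -?/a -?/b -?/c; ring.
have s4 : res5 4 (g ^+ 2) = c ^+ 2 by rewrite expr2 res5M g3 g4 -?/a -?/b -?/c; ring.
rewrite (exprM g 2 2) [_ ^+ 2 ^+ 2]expr2.
case=> [|[|[|[|[|//]]]]] _; rewrite res5M s0 s1 s2 s3 s4 /quartic_part; ring.
Qed.

(** The residues 0, 2, 4 have weights 0, 1, 2, so weight r is residue 2r modulo 5. *)
Lemma res5_exp4_024 : res5 1 g = 0 -> res5 3 g = 0 ->
  forall r, (r < 5)%N ->
  res5 ((2 * r) %% 5) (g ^+ 4) = quartic_part r (res5 0 g) (res5 2 g) (res5 4 g).
Proof.
move=> g1 g3; set a := res5 0 g; set b := res5 2 g; set c := res5 4 g.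
have s0 : res5 0 (g ^+ 2) = a ^+ 2 by rewrite expr2 res5M g1 g3 -?/a -?/b -?/c; ring.
have s1 : res5 2 (g ^+ 2) = 2 * a * b by rewrite expr2 res5M g1 g3 -?/a -?/b -?/c; ring.
have s2 : res5 4 (g ^+ 2) = b ^+ 2 + 2 * a * c by rewrite expr2 res5M g1 g3 -?/a -?/b -?/c; ring.
have s3 : res5 1 (g ^+ 2) = 2 * b * c by rewrite expr2 res5M g1 g3 -?/a -?/b -?/c; ring.
have s4 : res5 3 (g ^+ 2) = c ^+ 2 by rewrite expr2 res5M g1 g3 -?/a -?/b -?/c; ring.
rewrite (exprM g 2 2) [_ ^+ 2 ^+ 2]expr2.
case=> [|[|[|[|[|//]]]]] _; rewrite res5M s0 s1 s2 s3 s4 /quartic_part; ring.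
Qed.

End Quartic.

Lemma fps_exp5D (g h : fps 'F_5) : (g + h) ^+ 5 = g ^+ 5 + h ^+ 5.
Proof.
by apply: exprDn_pchar; rewrite pnatE // inE five_eq0 eqxx.
Qed.

Lemma rmorph_octic_part (R S : comNzRingType) (phi : {rmorphism R -> S})
    (a0 a1 a2 b0 b1 b2 : R) :
  phi (octic_part a0 a1 a2 b0 b1 b2) =
  octic_part (phi a0) (phi a1) (phi a2) (phi b0) (phi b1) (phi b2).
Proof.
by rewrite /octic_part /quartic_part !(rmorph_nat, rmorphD, rmorphM, rmorphXn).
Qed.

(** * The parts of e and f, and the key fact *)

Section CubicDissection.

Let e := euler 'F_5 1.
Let f := euler 'F_5 2.
Let X := fpsX 'F_5.

(** Exponents 3 and 4 modulo 5 are not pentagonal; two Frobenius steps turn (q^25; q^25) into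
    e^25. *)
Lemma res5_e : [/\ res5 1 e = - (X * e ^+ 25), res5 3 e = 0 & res5 4 e = 0].
Proof.
split; last 2 first.
- by apply: res5_eq0 => n n_r; apply: euler_coef_eq0 => // t;
     rewrite !inE n_r mul1n => /or3P[] /eqP ->.
- by apply: res5_eq0 => n n_r; apply: euler_coef_eq0 => // t;
     rewrite !inE n_r mul1n => /or3P[] /eqP ->.
by rewrite /e (res5_euler _ (m := 1)) // expr1 (exprM _ 5 5) !euler_exp5.
Qed.

Lemma res5_f : [/\ res5 2 f = - (X ^+ 2 * f ^+ 25), res5 1 f = 0 & res5 3 f = 0].
Proof.
split; last 2 first.
- by apply: res5_eq0 => n n_r; apply: euler_coef_eq0 => // t;
     rewrite !inE n_r -modnMmr => /or3P[] /eqP ->.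
- by apply: res5_eq0 => n n_r; apply: euler_coef_eq0 => // t;
     rewrite !inE n_r -modnMmr => /or3P[] /eqP ->.
by rewrite /f (res5_euler _ (m := 2)) // (exprM _ 5 5) !euler_exp5.
Qed.

Lemma coef0_res5_0 (h : fps 'F_5) : res5 0 h 0%N = h 0%N.
Proof. by []. Qed.

Lemma res5_0_neq0 m : res5 0 (euler 'F_5 m) != 0.
Proof.
apply/eqP => /(congr1 (fun h : fps 'F_5 => h 0%N))/eqP.
by rewrite coef0_res5_0 coef0_euler coef_fps0 oner_eq0.
Qed.

Lemma cube_relation (K : idomainType) (nz3 : 3%:R != 0 :> K) (a b c : K) :
  a != 0 -> 3%:R * (a * (a * c + b ^+ 2)) = 0 -> a * c = - b ^+ 2.
Proof.
move=> nza /eqP; rewrite !mulf_eq0 (negPf nz3) (negPf nza) /= addr_eq0.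
by move/eqP.
Qed.

Lemma three_neq0 : 3%:R != 0 :> fps 'F_5.
Proof.
apply/eqP => /(congr1 (fun h : fps 'F_5 => h 0%N)).
by rewrite coef_fpsMn coef_fps1 coef_fps0 => /eqP.
Qed.

(** The part of e^3 with residue 2 is 3 a0 (a0 a2 + a1^2), and Jacobi's series makes it vanish. *)
Lemma res5_e_rel : res5 0 e * res5 2 e = - res5 1 e ^+ 2.
Proof.
have [_ e3 e4] := res5_e; have nz : res5 0 e != 0 := res5_0_neq0 1.
apply: (cube_relation three_neq0 nz).
rewrite -[RHS](@res5_euler_cube 1 2) // -/e [e ^+ 3]exprS (expr2 e) !res5M e3 e4; ring.
Qed.

Lemma res5_f_rel : res5 0 f * res5 4 f = - res5 2 f ^+ 2.
Proof.
have [_ f1 f3] := res5_f; have nz : res5 0 f != 0 := res5_0_neq0 2.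
apply: (cube_relation three_neq0 nz).
rewrite -[RHS](@res5_euler_cube 2 4) // -/f [f ^+ 3]exprS (expr2 f) !res5M f1 f3; ring.
Qed.

(** Both sides start at X^2, with coefficients 1 and -1. This rules out the factor y - x^2. *)
Lemma res5_nondegenerate : res5 0 f * res5 1 e ^+ 2 != res5 0 e ^+ 2 * res5 2 f.
Proof.
have [-> _ _] := res5_e; have [-> _ _] := res5_f; apply/eqP.
have -> : res5 0 f * (- (X * e ^+ 25)) ^+ 2 = X ^+ 2 * (res5 0 f * e ^+ 50) by ring.
have -> : res5 0 e ^+ 2 * - (X ^+ 2 * f ^+ 25) =
  X ^+ 2 * (- (res5 0 e ^+ 2 * f ^+ 25)) by ring.
have nzX : X ^+ 2 != 0 by rewrite expf_neq0 ?fpsX_neq0.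
have coef0X (h : fps 'F_5) k : h 0%N = 1 -> (h ^+ k) 0%N = 1.
  by move=> h0; elim: k => [|k IHk]; rewrite ?coef_fps1 // exprS coef0_fpsM h0 IHk mulr1.
have coef0_neq (a b c d : fps 'F_5) : a 0%N = 1 -> b 0%N = 1 -> c 0%N = 1 ->
    d 0%N = 1 -> a * b <> - (c * d).
  move=> a0 b0 c0 d0 /(congr1 (fun h : fps 'F_5 => h 0%N)).
  by rewrite coef_fpsN !coef0_fpsM a0 b0 c0 d0 => /eqP.
have e0 : e 0%N = 1 := coef0_euler _ _; have f0 : f 0%N = 1 := coef0_euler _ _.
move/(mulfI nzX); apply: coef0_neq; first exact: f0.
- exact: coef0X e0.
- exact: (coef0X (res5 0 e) 2 e0).
- exact: coef0X f0.
Qed.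

Lemma res5_octic : res5 2 ((e * f) ^+ 4) = - 2 * X ^+ 2 * (e * f) ^+ 20.
Proof.
have [e1 e3 e4] := res5_e; have [f2 f1 f3] := res5_f.
have erel := res5_e_rel; have frel := res5_f_rel.
have nondeg := res5_nondegenerate.
have nzA0 : res5 0 e != 0 := res5_0_neq0 1; have nzB0 : res5 0 f != 0 := res5_0_neq0 2.
have nze : e != 0 := euler_neq0 _ _; have nzf : f != 0 := euler_neq0 _ _.
have nzX : X != 0 := fpsX_neq0 _.
have [P [eP P2 P4]] := gauss_psi; rewrite -/e -/f in eP.
clearbody e f X.
have h0 := congr1 (res5 0) eP; have h1 := congr1 (res5 1) eP.
have h3 := congr1 (res5 3) eP; have h4 := congr1 (res5 4) eP.
rewrite !(expr2, res5M) e3 e4 f1 f3 P2 P4 in h0 h1 h3 h4.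
have D4 : res5 2 ((e * f) ^+ 4) =
    octic_part (res5 0 e) (res5 1 e) (res5 2 e) (res5 0 f) (res5 2 f) (res5 4 f).
  have Qe := res5_exp4_012 e3 e4; have Qf := res5_exp4_024 f1 f3.
  have [[Qf0 Qf1] Qf2] := (Qf 0%N isT, Qf 1%N isT, Qf 2 isT).
  have [Qf3 Qf4] := (Qf 3 isT, Qf 4 isT).
  (* Halving modulo 5, the residues 1, 2, 3, 4 of f^4 have weights 3, 1, 4, 2. *)
  rewrite exprMn res5M !Qe // [res5 0 (f ^+ 4)]Qf0 [res5 1 (f ^+ 4)]Qf3.
  by rewrite [res5 2 (f ^+ 4)]Qf1 [res5 3 (f ^+ 4)]Qf4 [res5 4 (f ^+ 4)]Qf2.
have eqE (g1 g2 k1 k2 : fps 'F_5) : g1 - g2 = k1 - k2 -> g1 = g2 -> k1 = k2.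
  by move=> gk /eqP; rewrite -subr_eq0 gk subr_eq0 => /eqP.
have nzA1 : res5 1 e != 0.
  by rewrite e1 oppr_eq0 mulf_neq0 ?expf_neq0.
have nzB1 : res5 2 f != 0.
  by rewrite f2 oppr_eq0 mulf_neq0 ?expf_neq0.
have E0 : res5 0 e * res5 0 P + res5 2 e * res5 3 P = res5 0 f ^+ 2.
  by apply: eqE h0; ring.
have E1 : res5 0 e * res5 1 P + res5 1 e * res5 0 P = 2 * res5 2 f * res5 4 f.
  by apply: eqE h1; ring.
have E3 : res5 0 e * res5 3 P + res5 2 e * res5 1 P = res5 4 f ^+ 2.
  by apply: eqE h3; ring.
have E4 : res5 1 e * res5 3 P = 2 * res5 0 f * res5 4 f + res5 2 f ^+ 2.
  by apply: eqE h4; ring.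
have fiveL : 5%:R = 0 :> {fraction fps 'F_5}.
  by rewrite -(rmorph_nat (@tofrac (fps 'F_5))) five_eq0 rmorph0.
pose phi : {rmorphism fps 'F_5 -> {fraction fps 'F_5}} := @tofrac (fps 'F_5).
have phi_inj : injective phi by move=> g h /eqP; rewrite tofrac_eq => /eqP.
clearbody phi; have phi_eq0 g : (phi g == 0) = (g == 0).
  by rewrite -[0 in LHS](rmorph0 phi) (inj_eq phi_inj).
have phiE g h : g = h -> phi g = phi h by move->.
pose rmE := (rmorph_nat phi, rmorphD phi, rmorphM phi, rmorphXn phi, rmorphN phi).
have [rho [oct cub]] : exists rho,
    octic_part (phi (res5 0 e)) (phi (res5 1 e)) (phi (res5 2 e))
      (phi (res5 0 f)) (phi (res5 2 f)) (phi (res5 4 f)) =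
      - 2 * rho ^+ 2 * (phi (res5 1 e) * phi (res5 2 f)) ^+ 4 /\
    (phi (res5 0 e) ^+ 5 + phi (res5 1 e) ^+ 5 + phi (res5 2 e) ^+ 5) *
      (phi (res5 0 f) ^+ 5 + phi (res5 2 f) ^+ 5 + phi (res5 4 f) ^+ 5) =
      rho ^+ 3 * (phi (res5 1 e) * phi (res5 2 f)) ^+ 5.
  apply: (@dissection_identity _ fiveL _ _ _ _ _ _
    (phi (res5 0 P)) (phi (res5 1 P)) (phi (res5 3 P))); rewrite ?phi_eq0 //.
  - by move/phiE: erel; rewrite !rmE.
  - by move/phiE: frel; rewrite !rmE.
  - by move: nondeg; rewrite -(inj_eq phi_inj) !rmE.
  - by move/phiE: E0; rewrite !rmE.
  - by move/phiE: E1; rewrite !rmE.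
  - by move/phiE: E3; rewrite !rmE.
  - by move/phiE: E4; rewrite !rmE.
have ABE : phi (res5 1 e) * phi (res5 2 f) = phi X ^+ 3 * phi (e * f) ^+ 25.
  rewrite -!rmorphXn -!rmorphM; apply: phiE; rewrite e1 f2 mulrNN mulrACA -exprS.
  by rewrite exprMn.
have e5 : phi (res5 0 e) ^+ 5 + phi (res5 1 e) ^+ 5 + phi (res5 2 e) ^+ 5 = phi e ^+ 5.
  by rewrite -!rmorphXn -!rmorphD -!fps_exp5D [in RHS](res5_sum e) e3 e4 !addr0.
have f5 : phi (res5 0 f) ^+ 5 + phi (res5 2 f) ^+ 5 + phi (res5 4 f) ^+ 5 = phi f ^+ 5.
  by rewrite -!rmorphXn -!rmorphD -!fps_exp5D [in RHS](res5_sum f) f1 f3 !addr0.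
have nzW : phi (e * f) != 0 by rewrite phi_eq0 mulf_neq0.
have W5 : phi (e * f) ^+ 5 = rho ^+ 3 * (phi X ^+ 3 * phi (e * f) ^+ 25) ^+ 5.
  by rewrite -ABE -cub e5 f5 -exprMn rmorphM.
(* With w = e f, [W5] reads w^5 = rho^3 X^15 w^125; cancelling w^5 leaves the cube of this product
   equal to 1. *)
have : rho * phi X ^+ 5 * phi (e * f) ^+ 40 = 1.
  apply: frac_cube_root1; apply: (mulIf (expf_neq0 5 nzW)); rewrite mul1r.
  have alg (R : comNzRingType) (r q w : R) :
    (r * q ^+ 5 * w ^+ 40) ^+ 3 * w ^+ 5 = r ^+ 3 * (q ^+ 3 * w ^+ 25) ^+ 5 by ring.
  by rewrite [RHS]W5; apply: alg.
move: oct; rewrite ABE => oct rho1; apply: phi_inj.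
transitivity (- 2 * rho ^+ 2 * (phi X ^+ 3 * phi (e * f) ^+ 25) ^+ 4).
  by rewrite -oct D4 rmorph_octic_part.
(* The square of rho X^5 w^40 = 1 is split off from -2 rho^2 X^12 w^100, leaving -2 X^2 w^20. *)
have alg (R : comNzRingType) (r q w : R) : - 2 * r ^+ 2 * (q ^+ 3 * w ^+ 25) ^+ 4 =
  - 2 * q ^+ 2 * w ^+ 20 * (r * q ^+ 5 * w ^+ 40) ^+ 2 by ring.
rewrite alg.
by rewrite rho1 expr1n mulr1 -!rmorphXn -(rmorph_nat phi) -rmorphN -!rmorphM.
Qed.

End CubicDissection.

(** * Extraction of the coefficients of index 25n + 22 *)

Theorem theorem1p3 (n : nat) :
  (cubic_partitions (25 * n + 22)%N = 0 %[mod 5])%Z.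
Proof.
pose e := euler 'F_5 1; pose f := euler 'F_5 2.
have efG : e * f * cubic_fps = 1 := cubic_fpsE.
have oct : res5 2 ((e * f) ^+ 4) = - 2 * fpsX 'F_5 ^+ 2 * (e * f) ^+ 20 := res5_octic.
(* The exponents are 0 or 1 modulo 5 in e^3 and 0 or 2 in f^3, so they never add up to 4. *)
have w3 : res5 4 ((e * f) ^+ 3) = 0.
  have e0 r : r != 0 %[mod 5] -> r != 1 %[mod 5] -> res5 r (e ^+ 3) = 0.
    exact: res5_euler_cube.
  have f0 r : r != 0 %[mod 5] -> r != 2 %[mod 5] -> res5 r (f ^+ 3) = 0.
    exact: res5_euler_cube.
  rewrite exprMn res5M (e0 2) // (e0 3) // (e0 4) // (f0 4) // (f0 3) //.
  by rewrite !(mul0r, mulr0, addr0).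
have nzw : e * f != 0 by rewrite mulf_neq0 ?euler_neq0.
move: (e * f) efG oct w3 nzw => w wG oct w3 nzw.
have w5 r : (0 < r < 5)%N -> res5 r (w ^+ 5) = 0.
  move=> r_bd; apply: res5_eq0 => k k_r; rewrite coef_fps_exp5 ifF //; lia.
have w5_0 : res5 0 (w ^+ 5) = w ^+ 5.
  by rewrite [RHS]res5_sum (w5 1%N) // (w5 2) // (w5 3) // (w5 4) // !addr0.
(* Multiplication by w^5, a series in q^5, commutes with taking residue 2, and w^5 [cubic_fps] =
   w^4. *)
have G2 : res5 2 cubic_fps = - 2 * fpsX 'F_5 ^+ 2 * (w ^+ 3) ^+ 5.
  apply: (mulfI (expf_neq0 5 nzw)); transitivity (res5 2 (w ^+ 5 * cubic_fps)).
    by rewrite res5M w5_0 (w5 1%N) // (w5 2) // (w5 3) // (w5 4) // !mul0r !addr0.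
  have alg (R : comNzRingType) (x y : R) :
    - 2 * x ^+ 2 * y ^+ 20 = y ^+ 5 * (- 2 * x ^+ 2 * (y ^+ 3) ^+ 5) by ring.
  by rewrite -alg -oct (exprSr w 4) -(mulrA (w ^+ 4)) wG mulr1.
(* Since 25n + 22 = 2 + 5(5n + 4), this coefficient is -2 times that of index 5n + 4 in w^3, which
   is 0 by [w3]. *)
have G0 : cubic_fps (25 * n + 22)%N = 0.
  have := congr1 (fun g : fps 'F_5 => g (25 * n + 22)%N) G2.
  rewrite coef_res5 ifT; last by lia.
  move=> ->; rewrite !mulNr coef_fpsN -mulrA mulr_natl coef_fpsMn coef_fpsXnM.
  rewrite ifF; last by lia.
  rewrite coef_fps_exp5 ifT; last by lia.
  rewrite (_ : (25 * n + 22 - 2) %/ 5 = 5 * n + 4)%N; last by lia.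
  have := congr1 (fun g : fps 'F_5 => g (5 * n + 4)%N) w3.
  by rewrite coef_res5 ifT ?coef_fps0; [move=> ->; rewrite mul0rn oppr0 | lia].
apply/eqP; rewrite eqz_mod_dvd subr0 (dvdz_pcharf (pchar_Fp (isT : prime 5))).
exact/eqP.
Qed.
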